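(* Consider the two-user state-dependent discrete memoryless broadcast channel $\mathrm{C}_1$ (Class I) with finite alphabets $\mathcal{W},\mathcal{X},\mathcal{Y}_1,\mathcal{Y}_2$, state distribution $p(w)$, transition law $p(y_1,y_2|x,w)$, and the state sequence known noncausally at the encoder. Let $\mathcal{C}_1$ be its capacity region. Let $\mathcal{P}_1$ be the set of all joint distributions $p_1$ of $(W,V_1,V_2,X,Y_1,Y_2)$, with auxiliary random variables $V_1\in\mathcal{V}_1$, $V_2\in\mathcal{V}_2$ on finite sets, of the form $$p(w)\,p(v_1,v_2|w)\,p(x|w,v_1,v_2)\,p(y_1,y_2|x,w)$$ (so that $(V_1,V_2)\to(X,W)\to(Y_1,Y_2)$ is a Markov chain). For $p_1\in\mathcal{P}_1$ let $\mathcal{R}_{1,\mathrm{out}}(p_1)$ be the set of all rate pairs $(R_1,R_2)$, $R_1,R_2\ge0$, satisfying simultaneously $$R_1\le I(V_1;Y_1)-I(V_1;W),\qquad R_2\le I(V_2;Y_2)-I(V_2;W).$$ Let $\mathcal{R}_{1,\mathrm{out}}=\bigcup_{p_1\in\mathcal{P}_1}\mathcal{R}_{1,\mathrm{out}}(p_1)$. Then $\mathcal{C}_1\subseteq\mathcal{R}_{1,\mathrm{out}}$.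
   Context: Channel model. A sender communicates over $\mathrm{N}$ channel uses with two non-cooperating receivers $\mathrm{D}_1,\mathrm{D}_2$. The state sequence $\mathbf{W}=(W_1,\dots,W_{\mathrm{N}})$ is i.i.d. $\sim p(w)$ and independent of the messages; the channel is memoryless: $p(\mathbf{y}_1,\mathbf{y}_2|\mathbf{x},\mathbf{w})=\prod_{n=1}^{\mathrm{N}}p(y_{1,n},y_{2,n}|x_n,w_n)$. The messages $M_t$, $t=1,2$, are independent and uniform on $\mathcal{M}_t=\{1,\dots,2^{\mathrm{N}R_t}\}$ ($2^{\mathrm{N}R_t}$ is treated as an integer without loss of generality). Codes for $\mathrm{C}_1$. A $((2^{\mathrm{N}R_1},2^{\mathrm{N}R_2}),\mathrm{N},P_e^{(\mathrm{N})})$ code consists of a deterministic encoder $\mathbf{X}=\mathbf{f}(m_1,m_2,\mathbf{W})\in\mathcal{X}^{\mathrm{N}}$, which uses the entire state sequence (noncausal side-information), and decoders $g_t:\mathcal{Y}_t^{\mathrm{N}}\to\mathcal{M}_t$, $t=1,2$. The error probability is $P_e^{(\mathrm{N})}=\max\{P_{e,1}^{(\mathrm{N})},P_{e,2}^{(\mathrm{N})}\}$, where $P_{e,t}^{(\mathrm{N})}=\Pr[g_t(\mathbf{Y}_t)\neq M_t]$, averaged over the uniform messages and the state sequence. Capacity region. $(R_1,R_2)$ is achievable if there is a sequence of such codes with $P_e^{(\mathrm{N})}\to0$ as $\mathrm{N}\to\infty$. $\mathcal{C}_1$ is the closure of the set of achievable rate pairs. *)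

(* Defs.v *)
From HB Require Import structures.
From mathcomp Require Import all_boot all_order all_algebra.
From mathcomp Require Import all_classical all_reals all_analysis.

Set Implicit Arguments.
Unset Strict Implicit.
Unset Printing Implicit Defensive.

Import Order.TTheory GRing.Theory Num.Theory.
Import numFieldNormedType.Exports.

Local Open Scope classical_set_scope.
Local Open Scope ring_scope.

Definition is_pmf (R : realType) (T : finType) (p : T -> R) : Prop :=
  (forall t, 0 <= p t) /\ \sum_(t : T) p t = 1.

Definition Pr (R : realType) (O : finType) (p : O -> R) (E : pred O) : R :=
  \sum_(o | E o) p o.

Definition log2 (R : realType) (x : R) : R := ln x / ln 2.

(* I(A;B), in bits, for random variables A and B on the finite probability
   space (O, p). Terms with Pr[A = a, B = b] = 0 vanish: 0 log 0 = 0. *)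
Definition mutual_info (R : realType) (O S T : finType) (p : O -> R)
    (A : O -> S) (B : O -> T) : R :=
  \sum_(a : S) \sum_(b : T)
    Pr p (fun o => (A o == a) && (B o == b)) *
    log2 (Pr p (fun o => (A o == a) && (B o == b)) /
          (Pr p (fun o => A o == a) * Pr p (fun o => B o == b))).

(* p(w) is [p_state w]; p(y1,y2|x,w) is [p_chan x w (y1, y2)]. *)
Record broadcast_channel (R : realType) (W X Y1 Y2 : finType) := BroadcastChannel {
  p_state : W -> R;
  p_chan : X -> W -> Y1 * Y2 -> R;
  p_state_pmf : is_pmf p_state;
  p_chan_pmf : forall x w, is_pmf (p_chan x w)
}.

Record code (W X Y1 Y2 : finType) (N K1 K2 : nat) := Code {
  enc : 'I_K1 -> 'I_K2 -> {ffun 'I_N -> W} -> {ffun 'I_N -> X};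
  dec1 : {ffun 'I_N -> Y1} -> 'I_K1;
  dec2 : {ffun 'I_N -> Y2} -> 'I_K2
}.

Section Coding.
Variables (R : realType) (W X Y1 Y2 : finType).
Variable ch : broadcast_channel R W X Y1 Y2.

(* Joint law of (M1, M2, W^N, Y1^N, Y2^N) induced by a code. *)
Definition code_law (N K1 K2 : nat) (c : code W X Y1 Y2 N K1 K2)
    (o : 'I_K1 * 'I_K2 * {ffun 'I_N -> W} * {ffun 'I_N -> Y1} * {ffun 'I_N -> Y2})
    : R :=
  let '(m1, m2, w, y1, y2) := o in
  K1%:R^-1 * K2%:R^-1 * (\prod_(n < N) p_state ch (w n)) *
  \prod_(n < N) p_chan ch (enc c m1 m2 w n) (w n) (y1 n, y2 n).

Definition error1 (N K1 K2 : nat) (c : code W X Y1 Y2 N K1 K2) : R :=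
  Pr (code_law c) (fun '(m1, _, _, y1, _) => dec1 c y1 != m1).

Definition error2 (N K1 K2 : nat) (c : code W X Y1 Y2 N K1 K2) : R :=
  Pr (code_law c) (fun '(_, m2, _, _, y2) => dec2 c y2 != m2).

Definition error (N K1 K2 : nat) (c : code W X Y1 Y2 N K1 K2) : R :=
  Num.max (error1 c) (error2 c).

(* Number of messages at rate r over N channel uses; 2^(N r) is rounded up when
   it is not an integer. *)
Definition num_msg (N : nat) (r : R) : nat := `|Num.ceil (2 `^ (N%:R * r))|%N.

Definition achievable (r : R * R) : Prop :=
  0 <= r.1 /\ 0 <= r.2 /\
  exists c : forall N, code W X Y1 Y2 N (num_msg N r.1) (num_msg N r.2),
    error (c N) @[N --> \oo] --> (0 : R).

Definition capacity_region : set (R * R) := closure [set r | achievable r].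

(* The joint distributions of (W, V1, V2, X, Y1, Y2) of the form
   p(w) p(v1,v2|w) p(x|w,v1,v2) p(y1,y2|x,w). *)
Definition P1 (V1 V2 : finType) (p : W * V1 * V2 * X * Y1 * Y2 -> R) : Prop :=
  exists (pV : W -> V1 * V2 -> R) (pX : W -> V1 -> V2 -> X -> R),
    (forall w, is_pmf (pV w)) /\
    (forall w v1 v2, is_pmf (pX w v1 v2)) /\
    (forall w v1 v2 x y1 y2,
       p (w, v1, v2, x, y1, y2) =
       p_state ch w * pV w (v1, v2) * pX w v1 v2 x * p_chan ch x w (y1, y2)).

Definition R1_out_of (V1 V2 : finType) (p : W * V1 * V2 * X * Y1 * Y2 -> R)
    : set (R * R) :=
  let rW := fun '(w, _, _, _, _, _) => w in
  let rV1 := fun '(_, v1, _, _, _, _) => v1 in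
  let rV2 := fun '(_, _, v2, _, _, _) => v2 in
  let rY1 := fun '(_, _, _, _, y1, _) => y1 in
  let rY2 := fun '(_, _, _, _, _, y2) => y2 in
  [set r | [/\ 0 <= r.1, 0 <= r.2,
      r.1 <= mutual_info p rV1 rY1 - mutual_info p rV1 rW &
      r.2 <= mutual_info p rV2 rY2 - mutual_info p rV2 rW]].

Definition R1_out : set (R * R) :=
  [set r | exists (V1 V2 : finType) (p : W * V1 * V2 * X * Y1 * Y2 -> R),
     P1 p /\ R1_out_of p r].

End Coding.

(* Main.v *)
Require Import Defs.
From mathcomp Require Import all_boot all_order all_algebra.
From mathcomp Require Import all_classical all_reals all_analysis.
From mathcomp Require Import ring lra.

(** Let V_i consist of M, the past outputs Y^(i-1) and the future states
    W_(i+1)^N. Then I(V_i; Y_i) - I(V_i; W_i) equals H(Y_i) - H(W_i) plus a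
    difference of consecutive values of H(M, Y^(j), W_(j+1)^N), so the sum over i
    telescopes (this replaces the Csiszar sum identity), and with Fano's inequality
    it is at least (1 - Pe) log K - 1. A time-sharing variable, included in V, turns
    this into a single-letter bound, valid for both users with the same law of
    (W, X), up to an error that vanishes with N.

    It remains to let the error go to 0. Given the law of (W, X), the quantity
    I(V; Y) - I(V; W) depends on V only through the sum over v of a function of
    P(V = v, W, X) that is positively homogeneous. By Caratheodory's theorem
    |W| |X| + 1 values of V suffice, separately for each user, and because the
    bounds involve (V1, W, X) and (V2, W, X) only separately, V1 and V2 can be
    coupled again afterwards. The admissible laws on this fixed alphabet form a
    compact set on which the bounds are continuous, so the limit is attained. *)

Set Implicit Arguments.
Unset Strict Implicit.
Unset Printing Implicit Defensive.

Import Order.TTheory GRing.Theory Num.Theory.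
Import numFieldNormedType.Exports.

Local Open Scope classical_set_scope.
Local Open Scope ring_scope.

(** * Entropy of finite random variables *)

(** Entropies are in nats; the factor [ln 2] that converts to bits enters only with [mutual_info].
    Since [ln] is 0 on nonpositive reals, [ent] vanishes there. *)
Definition ent (R : realType) (x : R) : R := - (x * ln x).

Section Entropy.
Variable R : realType.

Lemma ent0 : ent (0 : R) = 0.
Proof. by rewrite /ent mul0r oppr0. Qed.

(** The second summand is linear in [x]; it cancels between the two sums of [phi], which makes [phi]
    homogeneous. *)
Lemma entM (c x : R) : 0 <= c -> 0 <= x -> ent (c * x) = c * ent x + x * ent c.
Proof.
rewrite !le_eqVlt => /predU1P[<-|c0] /predU1P[<-|x0];
  rewrite ?(mul0r, mulr0, ent0, addr0)//.
rewrite /ent lnM//; ring.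
Qed.

Lemma continuous_ent : continuous (@ent R).
Proof.
move=> x; have [x0|x0|->] := ltgtP x 0.
- have e : ent x = 0 by rewrite /ent ln0 ?mulr0 ?oppr0// ltW.
  rewrite /continuous_at e; apply: cvg_near_cst.
  near=> y; rewrite /ent ln0 ?mulr0 ?oppr0//.
  by apply/ltW; near: y; exact: lt_nbhsl.
- apply: cvgN; apply: cvgM; first exact: cvg_id.
  exact: continuous_ln.
- rewrite /continuous_at ent0.
  (* [- y ln y = 2 y ln (1 / sqrt y) <= 2 sqrt y] *)
  have bound (y : R) : `|y| < 1 -> `|ent y| <= 2 * Num.sqrt `|y|.
    move=> y1; have [y0|y0] := leP y 0.
      by rewrite /ent ln0// mulr0 oppr0 normr0 mulr_ge0// sqrtr_ge0.
    move: y1; rewrite [`|y|]gtr0_norm// => y1; set s := Num.sqrt y.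
    have s0 : 0 < s by rewrite sqrtr_gt0.
    have ys : y = s ^+ 2 by rewrite sqr_sqrtr// ltW.
    rewrite /ent normrN normrM gtr0_norm// ler0_norm ?ln_le0 ?(ltW y1)//.
    have h : ln s^-1 <= s^-1 by rewrite ltW// ln_sublinear// invr_gt0.
    rewrite lnV// in h.
    rewrite ys lnXn//.
    have -> : s ^+ 2 * - (ln s *+ 2) = 2 * (s ^+ 2 * - ln s) by ring.
    rewrite ler_pM2l//; apply: (le_trans (ler_wpM2l (sqr_ge0 s) h)).
    by rewrite expr2 mulfK// gt_eqF.
  apply/cvgr0Pnorm_lt => e e0; near=> y.
  have y1 : `|y| < 1 by near: y; exact: (@nbhs0_lt _ R).
  apply: (le_lt_trans (bound _ y1)).
  rewrite -ltr_pdivlMl// mulrC.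
  have ye : `|y| < (e / 2) ^+ 2.
    by near: y; apply: (@nbhs0_lt _ R); rewrite exprn_gt0// divr_gt0.
  have e2 : 0 < e / 2 by rewrite divr_gt0.
  by move: ye; rewrite -ltr_sqrt ?exprn_gt0// sqrtr_sqr (gtr0_norm e2).
Unshelve. all: by end_near.
Qed.

(** Nonnegativity of relative entropy, from [ln t <= t - 1] at [t = b s / a s]. The inequality on
    total masses admits a [b] that is only a subprobability, as in Fano's inequality. *)
Lemma gibbs (S : finType) (a b : S -> R) :
  (forall s, 0 <= a s) -> (forall s, 0 <= b s) ->
  (forall s, b s = 0 -> a s = 0) -> \sum_s b s <= \sum_s a s ->
  \sum_s ent (a s) <= - \sum_s a s * ln (b s).
Proof.
move=> a0 b0 ab sab; rewrite -subr_le0 opprK -big_split/=.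
apply: (@le_trans _ _ (\sum_s (b s - a s))); last first.
  by rewrite sumrB subr_le0.
apply: ler_sum => s _.
have [as0|as0] := eqVneq (a s) 0.
  by rewrite as0 ent0 mul0r addr0 subr0.
have sa : 0 < a s by rewrite lt_def as0 a0.
have sb : 0 < b s.
  by rewrite lt_def b0 andbT; apply: contra_neq as0; exact: ab.
have := @le_ln1Dx R (b s / a s - 1).
rewrite ltrBrDl subrr divr_gt0// => /(_ isT).
rewrite [1 + _]addrC subrK ln_div// => h.
rewrite /ent; have -> : b s - a s = a s * (b s / a s - 1) by field.
by rewrite addrC -mulrBr ler_pM2l.
Qed.

Variables (O : finType) (p : O -> R).
Hypothesis p_pmf : is_pmf p.

Lemma Pr_gt0 (E : pred O) o : E o -> p o != 0 -> 0 < Pr p E.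
Proof.
move=> Eo po; have p0 := p_pmf.1.
by rewrite /Pr (bigD1 o)//= ltr_wpDr ?sumr_ge0// lt_def po p0.
Qed.

Definition entropy (S : finType) (A : O -> S) : R :=
  \sum_s ent (Pr p (fun o => A o == s)).

Lemma sum_Pr (S : finType) (A : O -> S) (F : S -> R) :
  \sum_s Pr p (fun o => A o == s) * F s = \sum_o p o * F (A o).
Proof.
rewrite [RHS](partition_big A predT)//=; apply: eq_bigr => s _.
by rewrite mulr_suml; apply: eq_bigr => o /eqP ->.
Qed.

Lemma Pr_ge0 (E : pred O) : 0 <= Pr p E.
Proof. by apply: sumr_ge0 => o _; case: p_pmf. Qed.

Lemma Pr_eq (E F : pred O) : E =1 F -> Pr p E = Pr p F.
Proof. exact: eq_bigl. Qed.

Lemma Pr_marginal (S : finType) (A : O -> S) (E : pred O) :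
  \sum_s Pr p (fun o => (A o == s) && E o) = Pr p E.
Proof.
rewrite [RHS](partition_big A predT)//=; apply: eq_bigr => s _.
by apply: eq_bigl => o; rewrite andbC.
Qed.

Lemma Pr_le (E F : pred O) : (forall o, E o -> F o) -> Pr p E <= Pr p F.
Proof.
move=> EF; rewrite /Pr (bigID E F)/= (eq_bigl E) => [|o].
  by rewrite lerDl sumr_ge0// => o _; case: p_pmf.
by case: (boolP (E o)) => [/EF ->|]; rewrite ?andbF.
Qed.

Lemma sum_Pr1 (S : finType) (A : O -> S) : \sum_s Pr p (fun o => A o == s) = 1.
Proof.
have := sum_Pr A (fun=> 1).
under eq_bigr do rewrite mulr1.
by under [in X in _ = X -> _]eq_bigr do rewrite mulr1; case: p_pmf => _ ->.
Qed.

Lemma entropyE (S : finType) (A : O -> S) :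
  entropy A = - \sum_o p o * ln (Pr p (fun o' => A o' == A o)).
Proof.
by rewrite -(sum_Pr A (fun s => ln (Pr p (fun o' => A o' == s)))) -sumrN.
Qed.

(** Entropy depends only on the partition that a variable induces. This identifies variables of
    different types in the telescoping sum. *)
Lemma eq_entropy (S T : finType) (A : O -> S) (B : O -> T) :
  (forall o o', (A o == A o') = (B o == B o')) -> entropy A = entropy B.
Proof.
move=> AB; rewrite !entropyE; congr (- _); apply: eq_bigr => o _.
by congr (_ * ln _); apply: Pr_eq => o'; exact: AB.
Qed.

(** Cross-entropy bound: subadditivity and Fano's inequality below each follow from a suitable
    choice of [q]. *)
Lemma entropy_le (S : finType) (A : O -> S) (q : S -> R) :
  (forall s, 0 <= q s) -> \sum_s q s <= 1 ->
  (forall o, q (A o) = 0 -> p o = 0) ->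
  entropy A <= - \sum_o p o * ln (q (A o)).
Proof.
move=> q0 q1 qp; rewrite -(sum_Pr A (fun s => ln (q s))); apply: gibbs => //.
- by move=> s; exact: Pr_ge0.
- by move=> s qs0; rewrite /Pr big1// => o /eqP As; apply: qp; rewrite As.
- by rewrite sum_Pr1.
Qed.

Lemma ln_prod (I : finType) (F : I -> R) :
  (forall i, 0 < F i) -> ln (\prod_i F i) = \sum_i ln (F i).
Proof.
move=> F0; suff: 0 < \prod_i F i /\ ln (\prod_i F i) = \sum_i ln (F i) by case.
elim/big_rec2: _ => [|i x y _ [y0 yx]]; first by rewrite ln1.
by rewrite lnM ?posrE ?F0// yx mulr_gt0.
Qed.

Lemma entropy_subadditive (N : nat) (Y : finType)
    (A : O -> {ffun 'I_N -> Y}) :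
  entropy A <= \sum_i entropy (fun o => A o i).
Proof.
(* The product of the marginals, whose cross-entropy is the sum of the marginal entropies. *)
pose q (y : {ffun 'I_N -> Y}) := \prod_i Pr p (fun o => A o i == y i).
have pos o i : p o != 0 -> 0 < Pr p (fun o' => A o' i == A o i).
  exact: Pr_gt0.
have -> : \sum_i entropy (fun o => A o i) = - \sum_o p o * ln (q (A o)).
  transitivity (\sum_i - \sum_o p o * ln (Pr p (fun o' => A o' i == A o i))).
    by apply: eq_bigr => i _; rewrite entropyE.
  rewrite sumrN exchange_big/=; congr (- _); apply: eq_bigr => o _.
  have [->|po] := eqVneq (p o) 0.
    by rewrite mul0r big1// => i _; rewrite mul0r.
  by rewrite -mulr_sumr ln_prod// => i; exact: pos.
apply: entropy_le => //.
- by move=> y; apply: prodr_ge0 => i _; exact: Pr_ge0.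
- rewrite /q -(bigA_distr_bigA (fun i y => Pr p (fun o => A o i == y))).
  by rewrite big1// => i _; rewrite (sum_Pr1 (fun o => A o i)).
- move=> o qo; apply/eqP/negPn/negP => po; move: qo; apply/eqP; rewrite gt_eqF//.
  by apply: prodr_gt0 => i _; exact: pos.
Qed.

Lemma fano (K : nat) (T : finType) (M : O -> 'I_K) (Y : O -> T) (g : T -> 'I_K) :
  entropy (fun o => (M o, Y o)) <=
  entropy Y + ln 2 + Pr p (fun o => g (Y o) != M o) * ln K%:R.
Proof.
have [x0 _|O0] := pickP {: O}; last first.
  by case: p_pmf => _; rewrite big_pred0// => /eqP; rewrite eq_sym oner_eq0.
have K0 : (0 < K%:R :> R) by rewrite ltr0n (leq_ltn_trans _ (ltn_ord (M x0))).
(* A guess for the law of M given Y = y: half of the mass sits on the decoded message, and each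
   other message gets 1/(2K). The total is at most 1, and an error costs the extra [ln K]. *)
pose c (m : 'I_K) y : R := if g y == m then 2^-1 else 2^-1 / K%:R.
have c0 m y : 0 < c m y by rewrite /c; case: ifP; rewrite ?divr_gt0 ?invr_gt0.
pose q (s : 'I_K * T) := Pr p (fun o => Y o == s.2) * c s.1 s.2.
have := @entropy_le _ (fun o => (M o, Y o)) q.
have -> : - \sum_o p o * ln (q (M o, Y o)) =
    entropy Y + ln 2 + Pr p (fun o => g (Y o) != M o) * ln K%:R.
  rewrite entropyE.
  have -> : ln 2 = \sum_o p o * (ln 2 : R).
    by rewrite -mulr_suml; case: p_pmf => _ ->; rewrite mul1r.
  rewrite /Pr mulr_suml [X in _ = _ + X]big_mkcond/= -!sumrN -!big_split/=.
  apply: eq_bigr => o _.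
  have [->|po] := eqVneq (p o) 0; first by rewrite !mul0r oppr0 !add0r if_same.
  have pY : 0 < \sum_(o' | Y o' == Y o) p o'.
    exact: (@Pr_gt0 (fun o' => Y o' == Y o)).
  rewrite /q /c /= lnM//; last exact: c0.
  by case: eqP => _ /=; rewrite ?lnM ?lnV ?posrE ?invr_gt0// /Pr; ring.
apply.
- by move=> s; rewrite mulr_ge0 ?Pr_ge0// ltW.
- rewrite -(pair_bigA _ (fun m y => q (m, y)))/= exchange_big/=.
  rewrite -(sum_Pr1 Y); apply: ler_sum => y _.
  rewrite /q /= -mulr_sumr ler_piMr ?Pr_ge0// (bigD1 (g y))//= {1}/c eqxx.
  apply: (@le_trans _ _ (2^-1 + \sum_(i < K) 2^-1 / K%:R)).
    rewrite lerD2l [leRHS](bigD1 (g y))//= ler_wpDl ?divr_ge0 ?invr_ge0//.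
    by apply: ler_sum => i; rewrite /c eq_sym => /negPf ->.
  rewrite sumr_const card_ord -[X in _ + X]mulr_natr divfK ?gt_eqF//; lra.
- move=> o qo; apply/eqP/negPn/negP => po; move: qo; apply/eqP.
  by rewrite gt_eqF// mulr_gt0//; exact: (@Pr_gt0 _ o).
Qed.

End Entropy.

(** * Single-letter converse *)

Section Phi.
Variables (R : realType) (W X Y : finType) (k : W * X -> Y -> R).

(** If [u] is P(V = v, (W, X) = .), the sum over v of [phi] is H(V, W) - H(V, Y). *)
Definition phi (u : W * X -> R) : R :=
  \sum_w ent (\sum_x u (w, x)) - \sum_y ent (\sum_z u z * k z y).

(** When the [u v] form a joint law of V and (W, X), this is I(V; Y) - I(V; W) in nats: [phi] of the
    sum is H(W) - H(Y), and H(V) cancels. *)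
Definition phi_gain (V : finType) (u : V -> W * X -> R) : R :=
  \sum_v phi (u v) - phi (fun z => \sum_v u v z).

Hypothesis k_pmf : forall z, is_pmf (k z).

(** Scaling adds total mass times [ent c] to each of the two sums. Both have the same total mass
    because [k] is stochastic, so the additions cancel. *)
Lemma phiM c u : 0 <= c -> (forall z, 0 <= u z) ->
  phi (fun z => c * u z) = c * phi u.
Proof.
move=> c0 u0; rewrite /phi.
have -> : \sum_w ent (\sum_x c * u (w, x)) =
    c * \sum_w ent (\sum_x u (w, x)) + (\sum_z u z) * ent c.
  rewrite mulr_sumr [\sum_z u z](eq_bigr (fun z => u (z.1, z.2))); last by case.
  rewrite -(pair_bigA _ (fun w x => u (w, x)))/= mulr_suml -big_split/=.
  by apply: eq_bigr => w _; rewrite -mulr_sumr entM// sumr_ge0.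
have -> : \sum_y ent (\sum_z c * u z * k z y) =
    c * \sum_y ent (\sum_z u z * k z y) + (\sum_z u z) * ent c.
  have -> : \sum_z u z = \sum_y \sum_z u z * k z y.
    rewrite exchange_big/=; apply: eq_bigr => z _.
    by rewrite -mulr_sumr (k_pmf z).2 mulr1.
  rewrite mulr_sumr mulr_suml -big_split/=; apply: eq_bigr => y _.
  under eq_bigr do rewrite -mulrA.
  rewrite -mulr_sumr entM// sumr_ge0// => z _.
  by rewrite mulr_ge0// (k_pmf z).1.
ring.
Qed.

End Phi.

(** * Product laws and masked sequences *)

Section Product.
Variables (R : realType) (N : nat) (T : finType) (F : 'I_N -> T -> R).

Lemma sum_prod_if (P : 'I_N -> pred T) :
  \sum_(f : {ffun 'I_N -> T} | [forall n, P n (f n)]) \prod_n F n (f n) =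
  \prod_n \sum_(t | P n t) F n t.
Proof.
under [RHS]eq_bigr do rewrite big_mkcond.
rewrite bigA_distr_bigA/= big_mkcond; apply: eq_bigr => f _.
case: ifPn => [/forallP Pf|/forallPn[n Pn]].
  by apply: eq_bigr => n _; rewrite Pf.
by rewrite (bigD1 n)//= (negPf Pn) mul0r.
Qed.

Lemma sum_prod_at i a : (forall n, \sum_t F n t = 1) ->
  \sum_(f : {ffun 'I_N -> T} | f i == a) \prod_n F n (f n) = F i a.
Proof.
move=> F1.
transitivity (\sum_(f : {ffun 'I_N -> T} | [forall n, (n == i) ==> (f n == a)])
    \prod_n F n (f n)).
  apply: eq_bigl => f; apply/idP/forallP => [fa n|/(_ i)]; last by rewrite eqxx.
  by apply/implyP => /eqP ->.
rewrite (sum_prod_if (fun n t => (n == i) ==> (t == a))) (bigD1 i)//= eqxx/=.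
rewrite big_pred1_eq big1 ?mulr1// => n /negPf ni.
by rewrite ni/= F1.
Qed.

End Product.

(** Past and future segments keep full length, with [None] at hidden places, so that their type does
    not depend on the time index and the index can be joined to the auxiliary variable. *)
Definition fmask (N : nat) (T : finType) (P : pred 'I_N) (f : {ffun 'I_N -> T}) :
    {ffun 'I_N -> option T} :=
  [ffun j => if P j then Some (f j) else None].

Lemma fmask_eqE N (T : finType) P (f g : {ffun 'I_N -> T}) :
  (fmask P f == fmask P g) = [forall j, P j ==> (f j == g j)].
Proof.
apply/eqP/forallP => [/ffunP fg j|fg].
  by apply/implyP => Pj; have := fg j; rewrite !ffunE Pj => -[->].
by apply/ffunP => j; rewrite !ffunE; case: ifP (fg j) => //= _ /eqP ->.
Qed.

(** * Single-letter bound for one user *)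

Section Converse.
Variables (R : realType) (W X Y : finType) (k : W * X -> Y -> R) (pW : W -> R).
Hypothesis k_pmf : forall z, is_pmf (k z).
Hypothesis pW_pmf : is_pmf pW.
Variables (N K : nat) (O : finType) (p : O -> R).
Hypothesis p_pmf : is_pmf p.
Variables (M : O -> 'I_K) (w : O -> {ffun 'I_N -> W}) (x : O -> {ffun 'I_N -> X})
  (y : O -> {ffun 'I_N -> Y}) (g : {ffun 'I_N -> Y} -> 'I_K).
Hypothesis N_gt0 : (0 < N)%N.

Definition aux (i : 'I_N) (o : O) :=
  (M o, fmask (fun j => j < i)%N (y o), fmask (fun j => i < j)%N (w o)).

Hypothesis Mw_law : forall m f,
  Pr p (fun o => (M o == m) && (w o == f)) = K%:R^-1 * \prod_n pW (f n).
(** The Markov chain V_i -> (W_i, X_i) -> Y_i. *)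
Hypothesis memoryless : forall i v b,
  Pr p (fun o => (aux i o == v) && (y o i == b)) =
  \sum_z Pr p (fun o => (aux i o == v) && ((w o i, x o i) == z)) * k z b.

Let Pe := Pr p (fun o => g (y o) != M o).

Let K_gt0 : 0 < K%:R :> R.
Proof.
have [x0 _|O0] := pickP {: O}; last first.
  by case: p_pmf => _; rewrite big_pred0// => /eqP; rewrite eq_sym oner_eq0.
by rewrite ltr0n (leq_ltn_trans _ (ltn_ord (M x0))).
Qed.

Let N_pos : 0 < N%:R :> R. Proof. by rewrite ltr0n. Qed.

Lemma Pr_state i a : Pr p (fun o => w o i == a) = pW a.
Proof.
rewrite -(Pr_marginal p (fun o => (M o, w o)))/=.
transitivity (\sum_(s : 'I_K * {ffun 'I_N -> W} | s.2 i == a)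
    K%:R^-1 * \prod_n pW (s.2 n)).
  rewrite [RHS]big_mkcond; apply: eq_bigr => -[m f] _ /=.
  case: ifPn => [/eqP fa|fa].
    rewrite -(Mw_law m f); apply: Pr_eq => o; rewrite xpair_eqE.
    by case: eqP => //= _; case: eqP => //= ->; rewrite fa eqxx.
  rewrite /Pr big_pred0// => o; rewrite xpair_eqE.
  by apply/negP => /andP[/andP[_ /eqP ->]]; apply/negP.
rewrite -(pair_big xpredT (fun f : {ffun _} => f i == a)
   (fun m f => K%:R^-1 * \prod_n pW (f n)))/=.
under eq_bigr do rewrite -mulr_sumr.
rewrite (@sum_prod_at _ _ _ (fun _ => pW)) => [|_]; last by case: pW_pmf.
rewrite sumr_const card_ord -[LHS]mulr_natl mulrA mulfV ?mul1r//.
by rewrite gt_eqF.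
Qed.

Lemma entropy_Mw :
  entropy p (fun o => (M o, w o)) = ln K%:R + N%:R * \sum_a ent (pW a).
Proof.
rewrite entropyE//.
transitivity (\sum_o (p o * ln K%:R + \sum_i - (p o * ln (pW (w o i))))).
  rewrite -sumrN; apply: eq_bigr => o _.
  have [->|po] := eqVneq (p o) 0.
    by rewrite !mul0r oppr0 add0r big1// => i _; rewrite mul0r oppr0.
  rewrite (@Pr_eq _ _ _ _ (fun o' => (M o' == M o) && (w o' == w o))) => [|o'];
    last by rewrite xpair_eqE.
  have pos i : 0 < pW (w o i).
    by rewrite -(Pr_state i); apply: (Pr_gt0 p_pmf _ po).
  rewrite Mw_law lnM ?posrE ?invr_gt0 ?prodr_gt0// lnV// ln_prod//.
  by rewrite mulrDr mulrN opprD opprK mulr_sumr sumrN.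
rewrite big_split/= -mulr_suml p_pmf.2 mul1r; congr (_ + _).
rewrite exchange_big/= mulr_natl -[N in RHS]card_ord -sumr_const.
apply: eq_bigr => i _; rewrite sumrN -(sum_Pr p (fun o => w o i) (fun a => ln (pW a))).
by rewrite -sumrN; apply: eq_bigr => a _; rewrite Pr_state.
Qed.

(* Both summands below are values of [H(M, Y^(j), W_(j+1)^N)], at [j = i - 1] and
   [j = i], which is why the sum telescopes. *)
Lemma telescope :
  \sum_i (entropy p (fun o => (aux i o, w o i)) -
          entropy p (fun o => (aux i o, y o i))) =
  entropy p (fun o => (M o, w o)) - entropy p (fun o => (M o, y o)).
Proof.
pose G (j : nat) := entropy p (fun o =>
  (M o, fmask (fun n : 'I_N => n < j)%N (y o),
   fmask (fun n : 'I_N => j <= n)%N (w o))).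
transitivity (\sum_(i < N) (G i - G i.+1)).
  apply: eq_bigr => i _; congr (_ - _); apply: eq_entropy => // o o';
    rewrite !xpair_eqE !fmask_eqE -!andbA; congr (_ && _).
    congr (_ && _); apply/andP/forallP => [[/forallP h /eqP hi] n|h].
      apply/implyP; rewrite leq_eqVlt => /predU1P[|ni]; last exact: implyP (h n) ni.
      by move=> /val_inj <-; apply/eqP.
    split; last exact: implyP (h i) (leqnn _).
    by apply/forallP => n; apply/implyP => /ltnW; exact/implyP.
  rewrite andbA andbAC; congr (_ && _).
  apply/andP/forallP => [[/forallP h /eqP hi] n|h].
    apply/implyP; rewrite ltnS leq_eqVlt => /predU1P[|ni]; last exact: implyP (h n) ni.
    by move=> /val_inj ->; apply/eqP.
  split; last exact: implyP (h i) (leqnn _).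
  by apply/forallP => n; apply/implyP => ni; apply: (implyP (h n)); exact: ltnW.
rewrite -(big_mkord xpredT (fun i => G i - G i.+1)).
have -> : \sum_(0 <= i < N) (G i - G i.+1) = - \sum_(0 <= i < N) (G i.+1 - G i).
  by rewrite -sumrN; apply: eq_bigr => i _; rewrite opprB.
rewrite telescope_sumr// opprB; congr (_ - _); apply: eq_entropy => // o o';
  rewrite !xpair_eqE !fmask_eqE -?andbA; congr (_ && _).
  rewrite (_ : [forall _, _] = true) ?andTb; last exact/forallP.
  by apply/forallP/eqP => [h|-> n]; [apply/ffunP => n; apply/eqP; exact: h|exact/implyP].
rewrite andbC (_ : [forall _, _] = true) ?andTb; last first.
  by apply/forallP => n; rewrite leqNgt ltn_ord.
apply/forallP/eqP => [h|-> n]; last by rewrite eqxx implybT.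
by apply/ffunP => n; apply/eqP; move: (h n); rewrite ltn_ord.
Qed.

(** The first component of [v] is the time-sharing variable, uniform on ['I_N]; given it, this is
    the joint law of V_i and (W_i, X_i). *)
Definition aux_law (v : 'I_N * _) (z : W * X) : R :=
  N%:R^-1 * Pr p (fun o => (aux v.1 o == v.2) && ((w o v.1, x o v.1) == z)).

Lemma aux_law_ge0 v z : 0 <= aux_law v z.
Proof. by rewrite mulr_ge0 ?invr_ge0 ?Pr_ge0. Qed.

Lemma sum_aux_law z : \sum_v aux_law v z =
  N%:R^-1 * \sum_i Pr p (fun o => (w o i, x o i) == z).
Proof.
rewrite -(pair_bigA _ (fun i v => aux_law (i, v) z))/= mulr_sumr.
apply: eq_bigr => i _; rewrite -mulr_sumr; congr (_ * _).
exact: (Pr_marginal p (aux i) (fun o => (w o i, x o i) == z)).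
Qed.

Lemma sum_aux_law_state a : \sum_b \sum_v aux_law v (a, b) = pW a.
Proof.
under eq_bigr do rewrite sum_aux_law.
rewrite -mulr_sumr exchange_big/=.
transitivity (N%:R^-1 * \sum_(i < N) pW a); last first.
  by rewrite sumr_const card_ord -[X in _ * X]mulr_natl mulKf// gt_eqF.
congr (_ * _); apply: eq_bigr => i _.
rewrite -(Pr_state i a) -(Pr_marginal p (fun o => x o i)).
apply: eq_bigr => b _; apply: Pr_eq => o.
by rewrite xpair_eqE andbC.
Qed.

Lemma Pr_output i b : Pr p (fun o => y o i == b) =
  \sum_z Pr p (fun o => (w o i, x o i) == z) * k z b.
Proof.
rewrite -(Pr_marginal p (aux i)).
under eq_bigr do rewrite memoryless.
rewrite exchange_big/=; apply: eq_bigr => z _.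
rewrite -mulr_suml; congr (_ * _).
exact: (Pr_marginal p (aux i) (fun o => (w o i, x o i) == z)).
Qed.

(** Homogeneity of [phi] takes out the weight 1/N; what remains at time i is H(V_i, W_i) - H(V_i,
    Y_i), and [telescope] applies. *)
Lemma sum_phi_aux_law : N%:R * \sum_v phi k (aux_law v) =
  entropy p (fun o => (M o, w o)) - entropy p (fun o => (M o, y o)).
Proof.
rewrite -telescope -(pair_bigA _ (fun i v => phi k (aux_law (i, v))))/= mulr_sumr.
apply: eq_bigr => i _; rewrite /entropy.
rewrite -(pair_bigA _ (fun v a => ent (Pr p (fun o => (aux i o, w o i) == (v, a)))))/=.
rewrite -(pair_bigA _ (fun v a => ent (Pr p (fun o => (aux i o, y o i) == (v, a)))))/=.
rewrite -sumrB mulr_sumr; apply: eq_bigr => v _.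
rewrite /aux_law/= phiM ?invr_ge0//; last by move=> z; exact: Pr_ge0.
rewrite mulVKf ?gt_eqF// /phi; congr (_ - _).
  apply: eq_bigr => a _; congr ent.
  rewrite -(Pr_marginal p (fun o => x o i)); apply: eq_bigr => b _.
  by apply: Pr_eq => o; rewrite !xpair_eqE; case: (aux i o == v); rewrite ?andbF //= andbC.
apply: eq_bigr => b _; congr ent; rewrite -memoryless.
by apply: Pr_eq => o; rewrite xpair_eqE.
Qed.

(** Time sharing leaves the state law [pW] unchanged, while the output law becomes the average of
    the laws of the Y_i. Its entropy is at least the average entropy by concavity, here through
    [gibbs]. *)
Lemma phi_sum_aux_law : N%:R * phi k (fun z => \sum_v aux_law v z) <=
  N%:R * (\sum_a ent (pW a)) - \sum_i entropy p (fun o => y o i).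
Proof.
rewrite /phi mulrBr lerB//.
  by rewrite ler_wpM2l// ler_sum// => a _; rewrite sum_aux_law_state.
pose q b := \sum_z (\sum_v aux_law v z) * k z b.
have qE b : N%:R * q b = \sum_i Pr p (fun o => y o i == b).
  under [RHS]eq_bigr do rewrite Pr_output.
  rewrite exchange_big/= /q mulr_sumr; apply: eq_bigr => z _.
  by rewrite sum_aux_law mulrA mulVKf ?gt_eqF// mulr_suml.
have -> : N%:R * \sum_b ent (q b) =
    \sum_(i < N) - \sum_b Pr p (fun o => y o i == b) * ln (q b).
  rewrite [RHS]sumrN exchange_big/= mulr_sumr -[RHS]sumrN; apply: eq_bigr => b _.
  by rewrite -mulr_suml -qE /ent mulrN mulrA.
have q0 b : 0 <= q b.
  apply: sumr_ge0 => z _; rewrite mulr_ge0 ?(k_pmf z).1//.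
  by apply: sumr_ge0 => v _; exact: aux_law_ge0.
apply: ler_sum => i _; apply: gibbs => //.
- by move=> b; exact: Pr_ge0.
- move=> b qb; apply/eqP; rewrite eq_le Pr_ge0// andbT.
  rewrite -[leRHS](mulr0 N%:R) -qb qE (bigD1 i)//= lerDl sumr_ge0// => j _.
  exact: Pr_ge0.
- rewrite (sum_Pr1 p_pmf (fun o => y o i)) -(ler_pM2l N_pos) mulr_sumr.
  under eq_bigr do rewrite qE.
  rewrite exchange_big/= mulr1 (eq_bigr (fun=> 1)) => [|j _].
    by rewrite sumr_const card_ord.
  exact: (sum_Pr1 p_pmf (fun o => y o j)).
Qed.

(** N H(W) cancels between the two parts of the gain. Subadditivity compares the sum of the H(Y_i)
    with H(Y^N), and Fano's inequality bounds H(M, Y^N) - H(Y^N). *)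
Lemma converse_aux_law :
  (1 - Pe) * ln K%:R - ln 2 <= N%:R * phi_gain k aux_law.
Proof.
have := fano p_pmf M y g; have := entropy_subadditive p_pmf y.
have := phi_sum_aux_law; have := sum_phi_aux_law.
have -> : N%:R * phi_gain k aux_law = N%:R * \sum_v phi k (aux_law v) -
    N%:R * phi k (fun z => \sum_v aux_law v z) by exact: mulrBr.
rewrite entropy_Mw -/Pe; lra.
Qed.

End Converse.

(** * The law induced by a memoryless channel *)

Section Memoryless.
Variables (R : realType) (W X Y : finType) (k : W * X -> Y -> R) (pW : W -> R).
Hypothesis k_pmf : forall z, is_pmf (k z).
Hypothesis pW_pmf : is_pmf pW.
Variables (N K : nat) (S : finType) (mu : S -> R).
Hypothesis mu_pmf : is_pmf mu.
Variables (M : S -> 'I_K) (w : S -> {ffun 'I_N -> W}) (x : S -> {ffun 'I_N -> X})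
  (g : {ffun 'I_N -> Y} -> 'I_K).
Hypothesis Mw_law : forall m f,
  Pr mu (fun s => (M s == m) && (w s == f)) = K%:R^-1 * \prod_n pW (f n).

(** [s] gathers everything fixed before transmission, including the other user's message, so each
    user is treated as the receiver of a point-to-point channel. *)
Definition output_law (o : S * {ffun 'I_N -> Y}) : R :=
  mu o.1 * \prod_n k (w o.1 n, x o.1 n) (o.2 n).

Lemma Pr_output_law (E : S -> pred {ffun 'I_N -> Y}) :
  Pr output_law (fun o => E o.1 o.2) =
  \sum_s mu s * \sum_(y | E s y) \prod_n k (w s n, x s n) (y n).
Proof.
rewrite /Pr -(pair_big_dep xpredT E (fun s y => output_law (s, y)))/=.
by apply: eq_bigr => s _; rewrite mulr_sumr.
Qed.

Let prod_pmf s : \sum_(y : {ffun 'I_N -> Y}) \prod_n k (w s n, x s n) (y n) = 1.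
Proof.
rewrite -(bigA_distr_bigA (fun n y => k (w s n, x s n) y)) big1// => n _.
exact: (k_pmf _).2.
Qed.

Lemma Pr_output_law_input (E : pred S) :
  Pr output_law (fun o => E o.1) = Pr mu E.
Proof.
rewrite (Pr_output_law (fun s _ => E s)) /Pr [RHS]big_mkcond.
apply: eq_bigr => s _.
by case: ifP => _; [rewrite prod_pmf mulr1 | rewrite big_pred0// mulr0].
Qed.

Lemma output_law_pmf : is_pmf output_law.
Proof.
split=> [so|]; last first.
  rewrite -mu_pmf.2; exact: (Pr_output_law_input xpredT).
rewrite mulr_ge0 ?mu_pmf.1// prodr_ge0// => n _; exact: (k_pmf _).1.
Qed.

Lemma sum_past_present (i : 'I_N) (past : {ffun 'I_N -> option Y}) b s :
  \sum_(y : {ffun 'I_N -> Y} | (fmask (fun j : 'I_N => j < i)%N y == past) && (y i == b))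
    \prod_n k (w s n, x s n) (y n) =
  (\sum_(y : {ffun 'I_N -> Y} | fmask (fun j : 'I_N => j < i)%N y == past)
    \prod_n k (w s n, x s n) (y n)) * k (w s i, x s i) b.
Proof.
have maskE (y : {ffun 'I_N -> Y}) : (fmask (fun j : 'I_N => j < i)%N y == past) =
    [forall n : 'I_N, (if (n < i)%N then Some (y n) else None) == past n].
  apply/eqP/forallP => [ <- n|h]; first by rewrite ffunE.
  by apply/ffunP => n; rewrite ffunE; exact/eqP.
under [X in _ = X * _]eq_bigl do rewrite maskE.
rewrite (sum_prod_if (fun n y => k (w s n, x s n) y)
  (fun n t => (if (n < i)%N then Some t else None) == past n)).
transitivity (\sum_(y : {ffun 'I_N -> Y} | [forall n : 'I_N,
    ((if (n < i)%N then Some (y n) else None) == past n) && ((n == i) ==> (y n == b))])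
    \prod_n k (w s n, x s n) (y n)).
  apply: eq_bigl => y; rewrite maskE.
  apply/andP/forallP => [[/forallP h /eqP yb] n|h].
    by rewrite h; apply/implyP => /eqP ->; apply/eqP.
  split; first by apply/forallP => n; case/andP: (h n).
  by case/andP: (h i) => _; rewrite eqxx.
rewrite (sum_prod_if (fun n y => k (w s n, x s n) y) (fun n t =>
  ((if (n < i)%N then Some t else None) == past n) && ((n == i) ==> (t == b)))).
rewrite (bigD1 i)//= [in RHS](bigD1 i)//= eqxx ltnn/= mulrAC; congr (_ * _).
  (* If [past i] is not [None], no sequence has this mask and both sides vanish. *)
  case: (None == past i) => /=; last by rewrite !big_pred0_eq mul0r.
  by rewrite big_pred1_eq (k_pmf _).2 mul1r.
by apply: eq_bigr => n /negPf ->; apply: eq_bigl => t; rewrite andbT.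
Qed.

Let auxO := aux (M \o fst) (w \o fst) (fun o : S * {ffun 'I_N -> Y} => o.2).

(** Given [s], the outputs are independent. M and the future states are functions of [s], so their
    dependence on X_i through the noncausal encoder does no harm. *)
Lemma output_law_memoryless i v b :
  Pr output_law (fun o => (auxO i o == v) && (o.2 i == b)) =
  \sum_z Pr output_law (fun o => (auxO i o == v) && ((w o.1 i, x o.1 i) == z)) * k z b.
Proof.
case: v => -[m c] d.
pose E s := (M s == m) && (fmask (fun j : 'I_N => i < j)%N (w s) == d).
have auxE o : (auxO i o == (m, c, d)) = E o.1 && (fmask (fun j : 'I_N => j < i)%N o.2 == c).
  by rewrite /auxO /aux /= !xpair_eqE /E andbAC.
(* Both sides equal the mean of the transition probability to [b] over the event that V_i = v. *)
transitivity (\sum_(o | auxO i o == (m, c, d)) output_law o * k (w o.1 i, x o.1 i) b);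
    last first.
  rewrite (partition_big (fun o => (w o.1 i, x o.1 i)) xpredT)//=.
  apply: eq_bigr => z _; rewrite mulr_suml.
  by apply: eq_bigr => o /andP[_ /eqP ->].
rewrite (@Pr_eq _ _ _ _ (fun o =>
  E o.1 && ((fmask (fun j : 'I_N => j < i)%N o.2 == c) && (o.2 i == b)))); last first.
  by move=> o; rewrite auxE andbA.
rewrite (Pr_output_law (fun s y =>
  E s && ((fmask (fun j : 'I_N => j < i)%N y == c) && (y i == b)))).
rewrite (eq_bigl _ _ auxE).
rewrite -(pair_big_dep xpredT (fun s y => E s && (fmask (fun j : 'I_N => j < i)%N y == c))
  (fun s y => output_law (s, y) * k (w s i, x s i) b))/=.
apply: eq_bigr => s _; case: (E s) => /=; last by rewrite !big_pred0_eq mulr0.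
by rewrite sum_past_present mulrA mulr_sumr mulr_suml.
Qed.

(** The law of (W, X) is expressed through [mu], [w] and [x] alone, without message or output, so
    that applications to the two users give the same law. *)
Lemma memoryless_converse : (0 < N)%N ->
  exists (V : finType) (u : V -> W * X -> R),
  [/\ forall v z, 0 <= u v z,
      forall z, \sum_v u v z =
        N%:R^-1 * \sum_i Pr mu (fun s => (w s i, x s i) == z),
      forall a, \sum_b \sum_v u v (a, b) = pW a &
      (1 - Pr output_law (fun o => g o.2 != M o.1)) * ln K%:R - ln 2 <=
      N%:R * phi_gain k u].
Proof.
move=> N0.
have Mw m f : Pr output_law (fun o => (M o.1 == m) && (w o.1 == f)) =
    K%:R^-1 * \prod_n pW (f n).
  by rewrite (Pr_output_law_input (fun s => (M s == m) && (w s == f))).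
eexists; exists (aux_law output_law (M \o fst) (w \o fst) (x \o fst)
  (fun o : S * {ffun 'I_N -> Y} => o.2)); split.
- exact: aux_law_ge0 output_law_pmf _ _ _ _.
- move=> z; rewrite sum_aux_law; congr (_ * _); apply: eq_bigr => i _.
  exact: (Pr_output_law_input (fun s => (w s i, x s i) == z)).
- by apply: (sum_aux_law_state pW_pmf output_law_pmf _ _ N0 Mw).
- exact: (converse_aux_law k_pmf pW_pmf output_law_pmf g N0 Mw output_law_memoryless).
Qed.

End Memoryless.

(** * Both users of the broadcast channel *)

Section CodeConverse.
Variables (R : realType) (W X Y1 Y2 : finType).
Variable ch : broadcast_channel R W X Y1 Y2.

Definition chan1 (z : W * X) (y : Y1) : R := \sum_b p_chan ch z.2 z.1 (y, b).
Definition chan2 (z : W * X) (y : Y2) : R := \sum_a p_chan ch z.2 z.1 (a, y).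

Lemma chan1_pmf z : is_pmf (chan1 z).
Proof.
have [p0 p1] := p_chan_pmf ch z.2 z.1; split=> [y|]; first by rewrite sumr_ge0.
by rewrite -p1 (pair_bigA _ (fun a b => p_chan ch z.2 z.1 (a, b)))/=;
  apply: eq_bigr => -[].
Qed.

Lemma chan2_pmf z : is_pmf (chan2 z).
Proof.
have [p0 p1] := p_chan_pmf ch z.2 z.1; split=> [y|]; first by rewrite sumr_ge0.
rewrite -p1 exchange_big/= (pair_bigA _ (fun a b => p_chan ch z.2 z.1 (a, b)))/=.
by apply: eq_bigr => -[].
Qed.

(* [u1] and [u2] stand for the joint laws of (V1, (W, X)) and (V2, (W, X)). *)
Definition feasible (V1 V2 : finType) (u1 : V1 -> W * X -> R) (u2 : V2 -> W * X -> R) :=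
  [/\ forall v z, 0 <= u1 v z, forall v z, 0 <= u2 v z,
      forall z, \sum_v u1 v z = \sum_v u2 v z &
      forall w, \sum_x \sum_v u1 v (w, x) = p_state ch w].

(** The one-user bound is applied twice to the same source law [mu] of (M1, M2, W^N), once with each
    marginal channel. *)
Lemma code_converse (N K1 K2 : nat) (c : Defs.code W X Y1 Y2 N K1 K2) :
  (0 < N)%N -> (0 < K1)%N -> (0 < K2)%N ->
  exists (V1 V2 : finType) (u1 : V1 -> W * X -> R) (u2 : V2 -> W * X -> R),
  [/\ feasible u1 u2,
      (1 - error1 ch c) * ln K1%:R - ln 2 <= N%:R * phi_gain chan1 u1 &
      (1 - error2 ch c) * ln K2%:R - ln 2 <= N%:R * phi_gain chan2 u2].
Proof.
move=> N0 K10 K20.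
have k10 : K1%:R != 0 :> R by rewrite pnatr_eq0 -lt0n.
have k20 : K2%:R != 0 :> R by rewrite pnatr_eq0 -lt0n.
pose S := ('I_K1 * 'I_K2 * {ffun 'I_N -> W})%type.
pose st (s : S) := s.2.
pose inp (s : S) := enc c s.1.1 s.1.2 s.2.
pose mu (s : S) := K1%:R^-1 * K2%:R^-1 * \prod_n p_state ch (s.2 n).
have pW_pmf := p_state_pmf ch.
have prod1 : \sum_(f : {ffun 'I_N -> W}) \prod_n p_state ch (f n) = 1.
  rewrite -(bigA_distr_bigA (fun _ => p_state ch)) big1// => n _.
  exact: pW_pmf.2.
have sum_mu (F : 'I_K1 -> 'I_K2 -> {ffun 'I_N -> W} -> R) :
    \sum_(s : S) F s.1.1 s.1.2 s.2 = \sum_m1 \sum_m2 \sum_f F m1 m2 f.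
  rewrite -(pair_bigA _ (fun m f => F m.1 m.2 f))/=.
  by rewrite -(pair_bigA _ (fun m1 m2 => \sum_f F m1 m2 f)).
have Pr_mu1 m f : Pr mu (fun s => (s.1.1 == m) && (st s == f)) =
    K1%:R^-1 * \prod_n p_state ch (f n).
  rewrite /Pr big_mkcond/= (sum_mu (fun m1 m2 f' =>
    if (m1 == m) && (f' == f) then mu (m1, m2, f') else 0)).
  rewrite (bigD1 m)//= [X in _ + X]big1 ?addr0 => [|m' /negPf ->]; last first.
    by rewrite big1// => ? _; rewrite big1.
  rewrite (eq_bigr (fun=> mu (m, Ordinal K20, f))) => [|m2 _]; last first.
    by rewrite eqxx/= -big_mkcond/= big_pred1_eq.
  rewrite sumr_const card_ord -[LHS]mulr_natl /mu/=.
  by rewrite !mulrA [_ * K1%:R^-1]mulrC mulfK.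
have Pr_mu2 m f : Pr mu (fun s => (s.1.2 == m) && (st s == f)) =
    K2%:R^-1 * \prod_n p_state ch (f n).
  rewrite /Pr big_mkcond/= (sum_mu (fun m1 m2 f' =>
    if (m2 == m) && (f' == f) then mu (m1, m2, f') else 0)).
  rewrite (eq_bigr (fun=> mu (Ordinal K10, m, f))) => [|m1 _]; last first.
    rewrite (bigD1 m)//= [X in _ + X]big1 ?addr0 => [|m' /negPf ->]; last first.
      by rewrite big1.
    by rewrite eqxx/= -big_mkcond/= big_pred1_eq.
  by rewrite sumr_const card_ord -[LHS]mulr_natl /mu/= !mulrA mulfV// mul1r.
have mu_pmf : is_pmf mu.
  split=> [s|].
    by rewrite !mulr_ge0 ?invr_ge0// prodr_ge0// => n _; exact: pW_pmf.1.
  rewrite (sum_mu (fun m1 m2 f => mu (m1, m2, f))) /mu/=.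
  under eq_bigr do under eq_bigr do rewrite -mulr_sumr prod1 mulr1.
  rewrite !sumr_const !card_ord -[X in X *+ _]mulr_natl -[LHS]mulr_natl.
  by field; rewrite k20.
have [V1 [u1 [u1_ge0 u1_sum u1_state u1_gain]]] :=
  memoryless_converse chan1_pmf pW_pmf mu_pmf inp (dec1 c) Pr_mu1 N0.
have [V2 [u2 [u2_ge0 u2_sum _ u2_gain]]] :=
  memoryless_converse chan2_pmf pW_pmf mu_pmf inp (dec2 c) Pr_mu2 N0.
have law_sum (E : S -> {ffun 'I_N -> Y1} -> {ffun 'I_N -> Y2} -> bool) :
    Pr (code_law ch c) (fun o => E o.1.1 o.1.2 o.2) =
    \sum_s \sum_y1 \sum_y2 if E s y1 y2 then code_law ch c (s, y1, y2) else 0.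
  rewrite /Pr big_mkcond.
  rewrite (pair_bigA _ (fun s y1 => \sum_y2 if E s y1 y2 then _ else 0))/=.
  rewrite (pair_bigA _ (fun sy y2 =>
    if E sy.1 sy.2 y2 then code_law ch c (sy.1, sy.2, y2) else 0))/=.
  by apply: eq_bigr => -[[]].
have err1 : error1 ch c =
    Pr (output_law chan1 mu st inp) (fun o => dec1 c o.2 != o.1.1.1).
  rewrite (Pr_output_law _ _ _ _ (fun s y => dec1 c y != s.1.1)).
  transitivity (Pr (code_law ch c) (fun o => dec1 c o.1.2 != o.1.1.1.1)).
    by apply: Pr_eq => -[[[[? ?] ?] ?] ?].
  rewrite (law_sum (fun s y1 _ => dec1 c y1 != s.1.1)).
  apply: eq_bigr => s _; rewrite mulr_sumr [RHS]big_mkcond.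
  apply: eq_bigr => y1 _; case: ifP => _; last by rewrite big1.
  (* Summing out the other user's output sequence turns the product of joint transition
     probabilities into a product of marginal ones. *)
  rewrite /chan1 bigA_distr_bigA/= mulr_sumr; apply: eq_bigr => y2 _.
  by case: s => -[].
have err2 : error2 ch c =
    Pr (output_law chan2 mu st inp) (fun o => dec2 c o.2 != o.1.1.2).
  rewrite (Pr_output_law _ _ _ _ (fun s y => dec2 c y != s.1.2)).
  transitivity (Pr (code_law ch c) (fun o => dec2 c o.2 != o.1.1.1.2)).
    by apply: Pr_eq => -[[[[? ?] ?] ?] ?].
  rewrite (law_sum (fun s _ y2 => dec2 c y2 != s.1.2)).
  apply: eq_bigr => s _; rewrite mulr_sumr [RHS]big_mkcond exchange_big/=.
  apply: eq_bigr => y2 _; case: ifP => _; last by rewrite big1.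
  rewrite /chan2 bigA_distr_bigA/= mulr_sumr; apply: eq_bigr => y1 _.
  by case: s => -[].
exists V1, V2, u1, u2; rewrite err1 err2; split=> //; split=> // z.
by rewrite u1_sum u2_sum.
Qed.

End CodeConverse.

(** * Cardinality bound *)

Section Caratheodory.
Variables (R : realType) (D : finType) (Phi : (D -> R) -> R).
Hypothesis PhiM : forall c u, 0 <= c -> (forall z, 0 <= u z) ->
  Phi (fun z => c * u z) = c * Phi u.

(** [(q, t)] is a sum of [n] points [(u v, Phi (u v))]. By homogeneity these form a cone, so the
    weights of a combination are absorbed in [u]. *)
Definition conic_rep n (q : D -> R) (t : R) := exists u : 'I_n -> D -> R,
  [/\ forall v z, 0 <= u v z, forall z, \sum_v u v z = q z & \sum_v Phi (u v) = t].

Lemma conic_rep_pad n q t : conic_rep n q t -> conic_rep n.+1 q t.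
Proof.
move=> [u [u0 uq ut]].
have Phi0 : Phi (fun=> 0) = 0.
  have := @PhiM 0 (fun=> 0) (lexx _) (fun=> lexx _).
  by rewrite !mul0r.
exists (fun i => if unlift ord0 i is Some j then u j else fun=> 0); split.
- by move=> v z; case: unliftP.
- move=> z; rewrite big_ord_recl unlift_none add0r -uq.
  by apply: eq_bigr => j _; rewrite liftK.
- rewrite big_ord_recl unlift_none Phi0 add0r -ut.
  by apply: eq_bigr => j _; rewrite liftK.
Qed.

(* The vectors [(u v, Phi (u v))] are too many to be linearly independent. Moving
   the weights along a linear relation [c], up to the largest entry of [c], keeps
   them nonnegative and makes one of them vanish. *)
Lemma conic_rep_drop n q t :
  (#|D| < n)%N -> conic_rep n.+1 q t -> conic_rep n q t.
Proof.
move=> Dn [u [u0 uq ut]].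
(* Row [i] is the point [(u i, Phi (u i))], with [Phi] in column [None]; there are more rows than
   the |D| + 1 columns. *)
pose A := \matrix_(i < n.+1, j < #|{: option D}|)
  if enum_val j is Some z then u i z else Phi (u i).
have [c [cA [i0 ci0]]] : exists c : 'rV[R]_n.+1, c *m A = 0 /\ exists i, 0 < c 0 i.
  have : kermx A != 0.
    rewrite kermx_eq0 /row_free neq_ltn (leq_ltn_trans (rank_leq_col A))//.
    by rewrite card_option; exact: Dn.
  move=> /matrix0Pn[i [j]]; have kA : row i (kermx A) *m A = 0.
    by rewrite -row_mul mulmx_ker row0.
  (* The relation is negated if necessary, so that its largest entry is positive and can serve as a
     divisor. *)
  rewrite neq_lt => /orP[ij|ij].
    exists (- row i (kermx A)); split; first by rewrite mulNmx kA oppr0.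
    by exists j; rewrite 2!mxE oppr_gt0.
  by exists (row i (kermx A)); split=> //; exists j; rewrite mxE.
have [i1 _ ci1] := @Order.TotalTheory.arg_maxP _ _ _ i0 xpredT (fun i => c 0 i) isT.
have c1 : 0 < c 0 i1 by apply: lt_le_trans ci0 _; exact: ci1.
pose l i := 1 - c 0 i / c 0 i1.
have l0 i : 0 <= l i by rewrite subr_ge0 ler_pdivrMr// mul1r; exact: ci1.
have l1 : l i1 = 0 by rewrite /l divff ?subrr// gt_eqF.
have cA_at (s : option D) :
    \sum_i c 0 i * (if s is Some z then u i z else Phi (u i)) = 0.
  have := congr1 (fun B : 'rV[R]__ => B 0 (enum_rank s)) cA.
  rewrite !mxE => e; rewrite -[RHS]e; apply: eq_bigr => i _.
  by rewrite mxE enum_rankK.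
have lE (F : 'I_n.+1 -> R) : \sum_i c 0 i * F i = 0 ->
    \sum_(j < n) l (lift i1 j) * F (lift i1 j) = \sum_i F i.
  move=> cF; have := @bigD1_ord _ +%R 0 _ i1 xpredT (fun i => l i * F i) isT.
  rewrite /= l1 mul0r add0r => <-.
  transitivity (\sum_i (F i - (c 0 i1)^-1 * (c 0 i * F i))).
    by apply: eq_bigr => i _; rewrite /l; ring.
  by rewrite sumrB -mulr_sumr cF mulr0 subr0.
exists (fun j z => l (lift i1 j) * u (lift i1 j) z); split.
- by move=> v z; rewrite mulr_ge0.
- by move=> z; rewrite (lE (fun i => u i z)) ?uq// (cA_at (Some z)).
- rewrite -ut -(lE (fun i => Phi (u i))) ?(cA_at None)//.
  by apply: eq_bigr => j _; rewrite PhiM.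
Qed.

Lemma caratheodory (V : finType) (u : V -> D -> R) : (forall v z, 0 <= u v z) ->
  conic_rep #|D|.+1 (fun z => \sum_v u v z) (\sum_v Phi (u v)).
Proof.
move=> u0.
have : conic_rep #|V| (fun z => \sum_v u v z) (\sum_v Phi (u v)).
  exists (fun i => u (enum_val i)); split => // [z|].
    by rewrite -(big_enum_val (fun v => u v z)).
  by rewrite -(big_enum_val (fun v => Phi (u v))).
elim: #|V| => [|n IHn] repn.
  elim: #|D|.+1 => // d; exact: conic_rep_pad.
(* Above |D| + 1 points one is dropped; otherwise zero points are added up to exactly |D| + 1, so
   that all families share one index type. *)
have [Dn|nD] := ltnP #|D| n; first exact/IHn/conic_rep_drop.
move: nD repn; elim: #|D| => [|d IHd].
  by rewrite leqn0 => /eqP ->.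
rewrite leq_eqVlt => /predU1P[->//|nd repn].
by apply: conic_rep_pad; exact: IHd.
Qed.

End Caratheodory.

(** * Coupling of the auxiliary variables *)

Section MutualInformation.
Variables (R : realType) (O : finType) (p : O -> R).
Hypothesis p_pmf : is_pmf p.

Lemma mutual_infoE (S T : finType) (A : O -> S) (B : O -> T) :
  mutual_info p A B = (entropy p A + entropy p B -
    \sum_a \sum_b ent (Pr p (fun o => (A o == a) && (B o == b)))) / ln 2.
Proof.
pose PA a := Pr p (fun o => A o == a); pose PB b := Pr p (fun o => B o == b).
pose PAB a b := Pr p (fun o => (A o == a) && (B o == b)).
have EA : entropy p A = - \sum_a \sum_b PAB a b * ln (PA a).
  rewrite /entropy -sumrN; apply: eq_bigr => a _.
  rewrite -mulr_suml /ent; congr (- (_ * _)).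
  rewrite -[LHS](Pr_marginal p B); apply: eq_bigr => b _.
  by apply: Pr_eq => o; rewrite andbC.
have EB : entropy p B = - \sum_a \sum_b PAB a b * ln (PB b).
  rewrite /entropy exchange_big/= -sumrN; apply: eq_bigr => b _.
  by rewrite -mulr_suml /ent; congr (- (_ * _)); rewrite -[LHS](Pr_marginal p A).
rewrite EA EB -!sumrN -!big_split/= mulr_suml; apply: eq_bigr => a _.
rewrite -!sumrN -!big_split/= mulr_suml; apply: eq_bigr => b _.
rewrite /log2 -/(PAB a b) -/(PA a) -/(PB b) mulrA; congr (_ / _).
have [->|ab0] := eqVneq (PAB a b) 0; first by rewrite ent0 !mul0r !oppr0 !addr0.
have PAB_gt0 : 0 < PAB a b by rewrite lt_def ab0 Pr_ge0.
have PA_gt0 : 0 < PA a.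
  by apply: (lt_le_trans PAB_gt0); apply: Pr_le => // o /andP[].
have PB_gt0 : 0 < PB b.
  by apply: (lt_le_trans PAB_gt0); apply: Pr_le => // o /andP[].
rewrite ln_div ?posrE ?mulr_gt0// lnM// /ent; ring.
Qed.

(** H(V) occurs in both mutual informations and cancels; the remaining entropies are determined by
    the joint laws of (V, Y) and (V, W). *)
Lemma mutual_info_gain (W X V Y : finType) (k : W * X -> Y -> R)
    (u : V -> W * X -> R) (rV : O -> V) (rW : O -> W) (rY : O -> Y) :
  (forall v y, Pr p (fun o => (rV o == v) && (rY o == y)) = \sum_z u v z * k z y) ->
  (forall v w, Pr p (fun o => (rV o == v) && (rW o == w)) = \sum_x u v (w, x)) ->
  mutual_info p rV rY - mutual_info p rV rW = phi_gain k u / ln 2.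
Proof.
move=> VY VW; rewrite !mutual_infoE -mulrBl; congr (_ / _).
have EY : entropy p rY = \sum_y ent (\sum_z (\sum_v u v z) * k z y).
  apply: eq_bigr => y _; congr ent; rewrite -(Pr_marginal p rV).
  under eq_bigr do rewrite VY.
  by rewrite exchange_big/=; apply: eq_bigr => z _; rewrite mulr_suml.
have EW : entropy p rW = \sum_w ent (\sum_x \sum_v u v (w, x)).
  apply: eq_bigr => w _; congr ent; rewrite -(Pr_marginal p rV).
  by under eq_bigr do rewrite VW; rewrite exchange_big.
under eq_bigr do under eq_bigr do rewrite VY.
under [in X in _ - X]eq_bigr do under eq_bigr do rewrite VW.
rewrite /phi_gain /phi sumrB -EY -EW; ring.
Qed.

End MutualInformation.

Section Indicator.
Variables (R : realType) (W X V Y : finType) (k : W * X -> Y -> R).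
Variable u : V -> W * X -> R.

Lemma sum_indicator_output v y :
  \sum_w \sum_v' \sum_x \sum_y'
    (if (v' == v) && (y' == y) then u v' (w, x) * k (w, x) y' else 0) =
  \sum_z u v z * k z y.
Proof.
transitivity (\sum_w \sum_x u v (w, x) * k (w, x) y).
  apply: eq_bigr => w _; rewrite (bigD1 v)//= [X in _ + X]big1 ?addr0; last first.
    by move=> v' /negPf ->; rewrite big1// => ? _; rewrite big1.
  by apply: eq_bigr => x _; rewrite eqxx -big_mkcond/= big_pred1_eq.
by rewrite pair_bigA; apply: eq_bigr => -[].
Qed.

Hypothesis k_pmf : forall z, is_pmf (k z).

Lemma sum_indicator_state v a :
  \sum_w \sum_v' \sum_x \sum_y'
    (if (v' == v) && (w == a) then u v' (w, x) * k (w, x) y' else 0) =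
  \sum_x u v (a, x).
Proof.
rewrite (bigD1 a)//= [X in _ + X]big1 ?addr0; last first.
  move=> w /negPf ->; rewrite big1// => v' _; rewrite andbF big1// => ? _.
  by rewrite big1.
rewrite (bigD1 v)//= [X in _ + X]big1 ?addr0; last first.
  by move=> v' /negPf ->; rewrite big1// => ? _; rewrite big1.
by apply: eq_bigr => x _; rewrite !eqxx -mulr_sumr (k_pmf _).2 mulr1.
Qed.

End Indicator.

Section Coupling.
Variables (R : realType) (W X Y1 Y2 : finType).
Variable ch : broadcast_channel R W X Y1 Y2.
Variables (V1 V2 : finType) (u1 : V1 -> W * X -> R) (u2 : V2 -> W * X -> R).
Hypothesis u12 : feasible ch u1 u2.

Let u1_ge0 v z : 0 <= u1 v z. Proof. by case: u12. Qed.
Let u2_ge0 v z : 0 <= u2 v z. Proof. by case: u12. Qed.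
Let q z := \sum_v u1 v z.
Let q_ge0 z : 0 <= q z. Proof. by rewrite sumr_ge0. Qed.
Let qE z : q z = \sum_v u2 v z.
Proof. by have [_ _ + _] := u12; exact. Qed.
Let q_state w : \sum_x q (w, x) = p_state ch w.
Proof. by have [_ _ _ +] := u12; exact. Qed.

(* Only the laws of (V1, W, X) and of (V2, W, X) matter, so V1 and V2 may be taken
   conditionally independent given (W, X). *)
Definition coupling v1 v2 z : R := u1 v1 z * u2 v2 z / q z.

Lemma coupling_ge0 v1 v2 z : 0 <= coupling v1 v2 z.
Proof. by rewrite divr_ge0 ?mulr_ge0. Qed.

Lemma coupling_left v1 z : \sum_v2 coupling v1 v2 z = u1 v1 z.
Proof.
rewrite -mulr_suml -mulr_sumr -qE.
(* Where [q z = 0] the quotient is 0 by convention, and [u1 v1 z] is 0 as a nonnegative term of a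
   zero sum. *)
have [q0|q0] := eqVneq (q z) 0; last by rewrite mulfK.
have /eqP := q0; rewrite psumr_eq0// => /allP/(_ v1).
by rewrite mem_index_enum => /(_ isT)/eqP ->; rewrite !mul0r.
Qed.

Lemma coupling_right v2 z : \sum_v1 coupling v1 v2 z = u2 v2 z.
Proof.
rewrite -mulr_suml -mulr_suml -/(q z).
have [q0|q0] := eqVneq (q z) 0; last by rewrite mulrC mulKf.
move: (q0); rewrite qE => /eqP; rewrite psumr_eq0// => /allP/(_ v2).
by rewrite mem_index_enum => /(_ isT)/eqP ->; rewrite !(mulr0, mul0r).
Qed.

Definition coupling_law (o : W * V1 * V2 * X * Y1 * Y2) : R :=
  let '(w, v1, v2, x, y1, y2) := o in
  coupling v1 v2 (w, x) * p_chan ch x w (y1, y2).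

Lemma Pr_coupling (E : W -> V1 -> V2 -> Y1 -> Y2 -> bool) :
  Pr coupling_law (fun '(w, v1, v2, _, y1, y2) => E w v1 v2 y1 y2) =
  \sum_w \sum_v1 \sum_v2 \sum_x \sum_y1 \sum_y2
    if E w v1 v2 y1 y2
    then coupling v1 v2 (w, x) * p_chan ch x w (y1, y2) else 0.
Proof.
rewrite /Pr big_mkcond/=; do 5 rewrite pair_bigA/=.
by apply: eq_bigr => -[[[[[? ?] ?] ?] ?] ?] _.
Qed.

Lemma Pr_coupling1 (E : W -> V1 -> Y1 -> bool) :
  Pr coupling_law (fun '(w, v1, _, _, y1, _) => E w v1 y1) =
  \sum_w \sum_v1 \sum_x \sum_y1 if E w v1 y1 then u1 v1 (w, x) * chan1 ch (w, x) y1 else 0.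
Proof.
rewrite (Pr_coupling (fun w v1 _ y1 _ => E w v1 y1)).
apply: eq_bigr => w _; apply: eq_bigr => v1 _.
rewrite exchange_big/=; apply: eq_bigr => x _.
rewrite exchange_big/=; apply: eq_bigr => y1 _.
case: (E w v1 y1); last by rewrite big1// => ? _; rewrite big1.
by under eq_bigr do rewrite -mulr_sumr; rewrite -mulr_suml coupling_left.
Qed.

Lemma Pr_coupling2 (E : W -> V2 -> Y2 -> bool) :
  Pr coupling_law (fun '(w, _, v2, _, _, y2) => E w v2 y2) =
  \sum_w \sum_v2 \sum_x \sum_y2 if E w v2 y2 then u2 v2 (w, x) * chan2 ch (w, x) y2 else 0.
Proof.
rewrite (Pr_coupling (fun w _ v2 _ y2 => E w v2 y2)).
apply: eq_bigr => w _; rewrite exchange_big/=; apply: eq_bigr => v2 _.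
rewrite exchange_big/=; apply: eq_bigr => x _.
under eq_bigr do rewrite exchange_big/=.
rewrite exchange_big/=; apply: eq_bigr => y2 _.
case: (E w v2 y2); last by rewrite big1// => ? _; rewrite big1.
by under eq_bigr do rewrite -mulr_sumr; rewrite -mulr_suml coupling_right.
Qed.

Lemma coupling_law_pmf : is_pmf coupling_law.
Proof.
split=> [[[[[[w v1] v2] x] y1] y2]|].
  by rewrite mulr_ge0 ?coupling_ge0// (p_chan_pmf ch x w).1.
transitivity (Pr coupling_law (fun '(w, v1, _, _, y1, _) => true)).
  by apply: eq_bigl => -[[[[[? ?] ?] ?] ?] ?].
rewrite (Pr_coupling1 (fun _ _ _ => true)) -(p_state_pmf ch).2.
apply: eq_bigr => w _; rewrite exchange_big/= -q_state.
apply: eq_bigr => x _; apply: eq_bigr => v1 _.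
by rewrite -mulr_sumr (chan1_pmf ch _).2 mulr1.
Qed.

Lemma coupling_P1 : P1 ch coupling_law.
Proof.
pose b w v1 v2 := \sum_x coupling v1 v2 (w, x).
have b_ge0 w v1 v2 : 0 <= b w v1 v2 by apply: sumr_ge0 => x _; exact: coupling_ge0.
have sum_b w : \sum_(v : V1 * V2) b w v.1 v.2 = p_state ch w.
  rewrite -(pair_bigA _ (b w))/= -q_state /b.
  under eq_bigr do rewrite exchange_big/=.
  rewrite exchange_big/=; apply: eq_bigr => x _.
  by apply: eq_bigr => v1 _; rewrite coupling_left.
(* A law of total mass 1 lives on an inhabited type, which supplies default values for the kernels
   below. *)
have [[[w0 v0] x0] _] : exists o : W * (V1 * V2) * X, True.
  apply: contrapT => no; have := (coupling_law_pmf).2.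
  rewrite big1 => [/eqP|[[[[[w v1] v2] x] y1] y2] _]; first by rewrite eq_sym oner_eq0.
  by case: no; exists (w, (v1, v2), x).
(* The conditional laws must be distributions even where the condition has probability 0; there a
   point mass is taken. *)
pose normalize (T : finType) (t0 : T) (f : T -> R) (t : T) : R :=
  if \sum_s f s == 0 then (t == t0)%:R else f t / \sum_s f s.
have normalize_pmf (T : finType) (t0 : T) f : (forall t, 0 <= f t) ->
    is_pmf (normalize T t0 f).
  move=> f0; rewrite /normalize; have [_|sf] := eqVneq (\sum_s f s) 0; split.
  - by move=> t; rewrite ler0n.
  - by rewrite (bigD1 t0)//= eqxx big1 ?addr0// => t /negPf ->.
  - by move=> t; rewrite divr_ge0// sumr_ge0.
  - by rewrite -mulr_suml mulfV.
have normalizeK (T : finType) (t0 : T) f t : (forall t, 0 <= f t) ->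
    (\sum_s f s) * normalize T t0 f t = f t.
  move=> f0; rewrite /normalize; case: ifPn => [/eqP sf|sf]; last first.
    by rewrite mulrC divfK.
  rewrite sf mul0r; have /eqP := sf; rewrite psumr_eq0// => /allP/(_ t).
  by rewrite mem_index_enum => /(_ isT)/eqP.
exists (fun w => normalize _ v0 (fun v => b w v.1 v.2)).
exists (fun w v1 v2 => normalize _ x0 (fun x => coupling v1 v2 (w, x))).
split; [|split] => [w|w v1 v2|w v1 v2 x y1 y2].
- exact: normalize_pmf.
- by apply: normalize_pmf => x; exact: coupling_ge0.
- congr (_ * _); rewrite -sum_b.
  rewrite (normalizeK _ v0 (fun v => b w v.1 v.2) (v1, v2))//=.
  by rewrite normalizeK// => ?; exact: coupling_ge0.
Qed.

Lemma feasible_R1_out r : 0 <= r.1 -> 0 <= r.2 ->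
  r.1 * ln 2 <= phi_gain (chan1 ch) u1 -> r.2 * ln 2 <= phi_gain (chan2 ch) u2 ->
  R1_out ch r.
Proof.
move=> r1 r2 g1 g2; exists V1, V2, coupling_law; split; first exact: coupling_P1.
have ln2 : 0 < ln 2 :> R by rewrite ln_gt0// ltr1n.
split=> //.
- rewrite (@mutual_info_gain _ _ _ coupling_law_pmf _ _ _ _ (chan1 ch) u1).
  + by rewrite ler_pdivlMr.
  + move=> v y; rewrite -sum_indicator_output.
    rewrite -(Pr_coupling1 (fun _ v1 y1 => (v1 == v) && (y1 == y))).
    by apply: Pr_eq => -[[[[[? ?] ?] ?] ?] ?].
  + move=> v w; rewrite -(sum_indicator_state u1 (chan1_pmf ch)).
    rewrite -(Pr_coupling1 (fun w' v1 _ => (v1 == v) && (w' == w))).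
    by apply: Pr_eq => -[[[[[? ?] ?] ?] ?] ?].
- rewrite (@mutual_info_gain _ _ _ coupling_law_pmf _ _ _ _ (chan2 ch) u2).
  + by rewrite ler_pdivlMr.
  + move=> v y; rewrite -sum_indicator_output.
    rewrite -(Pr_coupling2 (fun _ v2 y2 => (v2 == v) && (y2 == y))).
    by apply: Pr_eq => -[[[[[? ?] ?] ?] ?] ?].
  + move=> v w; rewrite -(sum_indicator_state u2 (chan2_pmf ch)).
    rewrite -(Pr_coupling2 (fun w' v2 _ => (v2 == v) && (w' == w))).
    by apply: Pr_eq => -[[[[[? ?] ?] ?] ?] ?].
Qed.

End Coupling.

(** * Compactness *)

Section Limit.
Variables (R : realType) (W X Y1 Y2 : finType).
Variable ch : broadcast_channel R W X Y1 Y2.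

Let ln2_gt0 : 0 < ln 2 :> R. Proof. by rewrite ln_gt0// ltr1n. Qed.
Let ln2_lt2 : ln 2 < 2 :> R. Proof. exact: ln_sublinear. Qed.

(** Rounding up only increases the number of messages. *)
Lemma ln_num_msg N (x : R) : N%:R * x * ln 2 <= ln (num_msg N x)%:R.
Proof.
have p0 : 0 < 2 `^ (N%:R * x) :> R by rewrite powR_gt0.
have ple : 2 `^ (N%:R * x) <= (num_msg N x)%:R :> R.
  rewrite /num_msg natr_absz ger0_norm ?ceil_ge//.
  by rewrite ceil_ge0 (lt_trans _ p0)// ltrN10.
by rewrite -ln_powR ler_ln// posrE// (lt_le_trans p0).
Qed.

Lemma num_msg_gt0 N (x : R) : (0 < num_msg N x)%N.
Proof.
have p0 : 0 < 2 `^ (N%:R * x) :> R by rewrite powR_gt0.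
by rewrite absz_gt0 ceil_neq0 p0 orbT.
Qed.

(** Of the slack [eta], one half pays for passing to a nearby achievable pair, a quarter for the
    term [ln 2 / N] and a quarter for the error probability; [ln 2 < 2] suffices throughout. *)
Lemma closure_approx (r : R * R) (eta : R) : capacity_region ch r -> 0 < eta ->
  exists (V1 V2 : finType) (u1 : V1 -> W * X -> R) (u2 : V2 -> W * X -> R),
  [/\ feasible ch u1 u2, r.1 * ln 2 - eta <= phi_gain (chan1 ch) u1 &
      r.2 * ln 2 - eta <= phi_gain (chan2 ch) u2].
Proof.
move=> clr eta0.
have eta4 : 0 < eta / 4 by rewrite divr_gt0.
have [r' [[r1 [r2 [c cvg_err]]] [/= b1 b2]]] := clr _ (nbhsx_ballx r _ eta4).
(* A positive bound on both rates: an error below [eta / 8 / s] costs at most [eta / 4]. *)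
pose s := r'.1 + r'.2 + 1.
have s0 : 0 < s by rewrite ltr_wpDl// addr_ge0.
have d0 : 0 < eta / 8 / s by rewrite !divr_gt0.
near \oo => N.
have N0 : 0 < N%:R :> R by near: N; exact: nbhs_infty_gtr.
have Neta : 8 / eta < N%:R by near: N; exact: nbhs_infty_gtr.
have err1 : error ch (c N) < 1.
  by near: N; apply: (cvgr_lt 0) => //; exact: ltr01.
have errd : error ch (c N) < eta / 8 / s.
  by near: N; exact: (cvgr_lt 0).
have N_gt0 : (0 < N)%N by rewrite -(ltr0n R).
have [V1 [V2 [u1 [u2 [u12 g1 g2]]]]] :=
  code_converse ch (c N) N_gt0 (num_msg_gt0 _ _) (num_msg_gt0 _ _).
have bound (x x' e g : R) : e <= error ch (c N) -> 0 <= x' -> x' <= s ->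
    `|x - x'| < eta / 4 ->
    (1 - e) * ln (num_msg N x')%:R - ln 2 <= N%:R * g -> x * ln 2 - eta <= g.
  move=> ee x'0 x's xx' h.
  have e1 : 0 <= 1 - e by rewrite subr_ge0 (le_trans ee)// ltW.
  have h1 : (1 - e) * (x' * ln 2) - ln 2 / N%:R <= g.
    rewrite -(ler_pM2l N0); apply: le_trans h; rewrite mulrBr.
    rewrite [N%:R * (ln 2 / _)]mulrCA mulfV ?gt_eqF// mulr1 lerD2r.
    by rewrite mulrCA ler_wpM2l// mulrA ln_num_msg.
  have h2 : ln 2 / N%:R <= eta / 4.
    rewrite ler_pdivrMr//; apply: (le_trans (ltW ln2_lt2)).
    by move: Neta; rewrite ltr_pdivrMr//; lra.
  have h3 : e * (x' * ln 2) <= eta / 4.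
    apply: (@le_trans _ _ (eta / 8 / s * (s * 2))); last first.
      by rewrite mulrA divfK ?gt_eqF//; lra.
    apply: (@le_trans _ _ (eta / 8 / s * (x' * ln 2))).
      by rewrite ler_wpM2r ?mulr_ge0 ?(ltW ln2_gt0)// (le_trans ee)// ltW.
    by rewrite ler_wpM2l ?(ltW d0)// ler_pM// ltW.
  have h4 : (x - x') * ln 2 <= eta / 2.
    apply: (@le_trans _ _ (eta / 4 * 2)); last by lra.
    apply: (@le_trans _ _ (`|x - x'| * ln 2)).
      by rewrite ler_wpM2r ?ler_norm// ltW.
    by rewrite ler_pM// ?ltW.
  lra.
exists V1, V2, u1, u2; split => //.
- apply: (bound _ r'.1 (error1 ch (c N))) => //.
    by rewrite /error le_max lexx.
  by rewrite /s -addrA lerDl addr_ge0.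
- apply: (bound _ r'.2 (error2 ch (c N))) => //.
    by rewrite /error le_max lexx orbT.
  by rewrite /s addrAC lerDr addr_ge0.
Unshelve. all: by end_near.
Qed.

Let m := #|{: W * X}|.+1.
(** A pair of families is a single point of a product of copies of R; the boolean is [true] for user
    1. *)
Let I := (bool * 'I_m * (W * X))%type.
Let T := prod_topology (fun _ : I => R).
Let family (b : bool) (f : T) : 'I_m -> W * X -> R := fun v z => f (b, v, z).

Let feasible_set : set T := [set f | feasible ch (family true f) (family false f)].

Lemma continuous_sum (U : topologicalType) (J : finType) (F : J -> U -> R) :
  (forall j, continuous (F j)) -> continuous (fun x => \sum_j F j x).
Proof. by move=> cF; apply: continuous_big => //; exact: add_continuous. Qed.

Lemma continuous_eval (i : I) : continuous (fun f : T => f i).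
Proof. exact: proj_continuous. Qed.

Lemma continuous_phi (U : topologicalType) (Y : finType) (k : W * X -> Y -> R)
    (F : U -> W * X -> R) :
  (forall z, continuous (fun f => F f z)) -> continuous (fun f => phi k (F f)).
Proof.
move=> cF; have cent (h : U -> R) : continuous h -> continuous (fun f => ent (h f)).
  by move=> hc f; apply: continuous_comp; [exact: hc|exact: continuous_ent].
move=> f; apply: continuousB.
  by apply: continuous_sum => w; apply: cent; apply: continuous_sum => x.
apply: continuous_sum => y; apply: cent; apply: continuous_sum => z g.
by apply: continuousM; [exact: cF|exact: cst_continuous].
Qed.

Lemma continuous_gain (Y : finType) (k : W * X -> Y -> R) b :
  continuous (fun f : T => phi_gain k (family b f)).
Proof.
move=> f; rewrite /phi_gain.
apply: (@continuousB _ R T (fun f => \sum_v phi k (family b f v))).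
  apply: continuous_sum => v; apply: continuous_phi => z.
  exact: continuous_eval.
apply: continuous_phi => z; apply: continuous_sum => v.
exact: continuous_eval.
Qed.

Lemma closed_forall_eq (U : topologicalType) (J : Type) (h : J -> U -> R) (c : J -> R) :
  (forall j, continuous (h j)) -> closed [set f | forall j, h j f = c j].
Proof.
move=> hc.
have -> : [set f | forall j, h j f = c j] =
    \bigcap_(j in setT) (h j @^-1` [set x | x = c j]).
  by apply/seteqP; split => f /= hf j => [_|]; exact: hf.
apply: closed_bigI => j _; apply: preimage_closed; last exact: closed_eq.
by move=> f _; exact: hc.
Qed.

(** The constraints are closed, and they force all entries into [0, 1]: the entries over v sum to at
    most p(w) <= 1. Tychonoff's theorem makes the cube compact. *)
Lemma compact_feasible_set : compact feasible_set.
Proof.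
pose cube : set T := [set f | forall i, `[0, 1]%classic (f i)].
have cube_compact : compact cube.
  by apply: (@tychonoff I (fun=> R) (fun=> `[0, 1]%classic)) => i; exact: segment_compact.
have sum_closed : closed [set f : T | forall z,
    \sum_v family true f v z - \sum_v family false f v z = 0].
  apply: (closed_forall_eq (h := fun z f =>
    \sum_v family true f v z - \sum_v family false f v z) (c := fun=> 0)) => z f.
  by apply: continuousB; apply: continuous_sum => v; exact: continuous_eval.
have state_closed : closed [set f : T | forall w,
    \sum_x \sum_v family true f v (w, x) = p_state ch w].
  apply: (closed_forall_eq (h := fun w f =>
    \sum_x \sum_v family true f v (w, x)) (c := p_state ch)) => w.
  by apply: continuous_sum => x; apply: continuous_sum => v; exact: continuous_eval.
have -> : feasible_set = cube `&` [set f : T | forall z,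
    \sum_v family true f v z - \sum_v family false f v z = 0] `&`
    [set f : T | forall w, \sum_x \sum_v family true f v (w, x) = p_state ch w].
  apply/seteqP; split => f /=; last first.
    move=> [[cf sf] wf]; split => //.
    - by move=> v z; have := cf (true, v, z); rewrite /= in_itv/= => /andP[].
    - by move=> v z; have := cf (false, v, z); rewrite /= in_itv/= => /andP[].
    - by move=> z; apply/eqP; rewrite -subr_eq0 sf.
  move=> [f1 f2 sf wf]; split=> //; split; last by move=> z; rewrite sf subrr.
  have le1 z : \sum_v family true f v z <= 1.
    case: z => w x; apply: (@le_trans _ _ (p_state ch w)).
      rewrite -wf (bigD1 x)//= lerDl sumr_ge0// => x' _; exact: sumr_ge0.
    have [p0 <-] := p_state_pmf ch; rewrite (bigD1 w)//= lerDl; exact: sumr_ge0.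
  move=> [[[] v] z] /=; rewrite in_itv/=.
    rewrite (f1 v z)/=; apply: le_trans (le1 z).
    by rewrite (bigD1 v)//= lerDl sumr_ge0.
  rewrite (f2 v z)/=; apply: le_trans (le1 z); rewrite sf.
  by rewrite (bigD1 v)//= lerDl sumr_ge0.
by do 2 apply: compact_closedI => //.
Qed.

(** Reduction to |W| |X| + 1 values keeps both the law of (W, X) and the sum of [phi], hence
    feasibility and gains. The smaller of the two slacks then has a maximum that is at least [- eta]
    for every [eta > 0]; using the minimum makes one maximizer serve both users. *)
Lemma feasible_attained (r : R * R) :
  (forall eta, 0 < eta ->
    exists (V1 V2 : finType) (u1 : V1 -> W * X -> R) (u2 : V2 -> W * X -> R),
    [/\ feasible ch u1 u2, r.1 * ln 2 - eta <= phi_gain (chan1 ch) u1 &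
        r.2 * ln 2 - eta <= phi_gain (chan2 ch) u2]) ->
  exists u1 u2 : 'I_m -> W * X -> R,
  [/\ feasible ch u1 u2, r.1 * ln 2 <= phi_gain (chan1 ch) u1 &
      r.2 * ln 2 <= phi_gain (chan2 ch) u2].
Proof.
move=> rapprox.
pose G (f : T) := Num.min (phi_gain (chan1 ch) (family true f) - r.1 * ln 2)
  (phi_gain (chan2 ch) (family false f) - r.2 * ln 2).
have approx eta : 0 < eta -> exists2 f, feasible_set f & - eta <= G f.
  move=> eta0; have [V1 [V2 [u1 [u2 [[p1 p2 s12 w1] g1 g2]]]]] := rapprox _ eta0.
  have phiM1 := @phiM _ _ _ _ _ (chan1_pmf ch).
  have phiM2 := @phiM _ _ _ _ _ (chan2_pmf ch).
  have [f1 [pf1 sf1 gf1]] := caratheodory phiM1 p1.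
  have [f2 [pf2 sf2 gf2]] := caratheodory phiM2 p2.
  exists (fun i : I => if i.1.1 then f1 i.1.2 i.2 else f2 i.1.2 i.2).
    split => //.
    - by move=> z; rewrite /family/= sf1 sf2.
    - by move=> w; rewrite -w1; apply: eq_bigr => x _; rewrite /family/= sf1.
  rewrite /G le_min; move: g1 g2; rewrite /phi_gain /family/= gf1 gf2.
  have -> : (fun z => \sum_v f1 v z) = (fun z => \sum_v u1 v z) by apply/funext.
  have -> : (fun z => \sum_v f2 v z) = (fun z => \sum_v u2 v z) by apply/funext.
  by move=> g1 g2; apply/andP; split; lra.
have contG : continuous G.
  pose gain1 (f : T) := phi_gain (chan1 ch) (family true f).
  pose gain2 (f : T) := phi_gain (chan2 ch) (family false f).
  move=> f; apply: (@continuous_min R T (fun f => gain1 f - r.1 * ln 2)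
    (fun f => gain2 f - r.2 * ln 2)).
    by apply: (@continuousB _ R T gain1); [exact: continuous_gain|exact: cst_continuous].
  by apply: (@continuousB _ R T gain2); [exact: continuous_gain|exact: cst_continuous].
have [|f ff fmax] := compact_EVT_max _ compact_feasible_set (continuous_subspaceT contG).
  by have [f ff _] := approx 1 ltr01; exists f.
have : 0 <= G f.
  apply/ler_addgt0Pr => eta eta0; rewrite -lerBlDr sub0r.
  have [f' ff' /le_trans] := approx eta eta0; apply; apply: fmax.
  exact/mem_set.
rewrite /G le_min !subr_ge0 => /andP[g1 g2].
by exists (family true f), (family false f); split=> //; exact: set_mem ff.
Qed.

End Limit.

Theorem theorem3p2 (R : realType) (W X Y1 Y2 : finType)
    (ch : broadcast_channel R W X Y1 Y2) :
  capacity_region ch `<=` R1_out ch.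
Proof.
move=> r clr.
(* Nonnegativity of the rates has to be carried over from achievable pairs to their closure. *)
have near0 e : 0 < e -> 0 <= r.1 + e /\ 0 <= r.2 + e.
  move=> e0; have [r' [[r1 [r2 _]] [/= b1 b2]]] := clr _ (nbhsx_ballx r _ e0).
  move: b1 b2; rewrite /ball/= !ltr_distlC => /andP[_ b1] /andP[_ b2].
  by split; [apply: le_trans r1 _|apply: le_trans r2 _]; exact: ltW.
have [u1 [u2 [u12 g1 g2]]] := feasible_attained (fun eta => closure_approx clr).
by apply: feasible_R1_out u12 _ _ _ g1 g2; apply/ler_addgt0Pr => e /near0[].
Qed.
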